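(* Let $a<b$ be real, $y\in(a,b)$, and let $n\ge2$ be an integer. Then $$\left(\frac{(n-2)\log 2}{32\min\{y-a,b-y\}}\right)^{1/2} \le \sup_{0\ne f\in\mathcal{E}_n}\frac{|f(y)|}{\|f\|_{L_2[a,b]}} \le \left(\frac{2n}{\min\{y-a,b-y\}}\right)^{1/2}.$$
   Context: $\mathcal{E}_n$ denotes the set of all functions $f(t)=\sum_{j=1}^na_je^{\lambda_jt}$ ($t\in\mathbb{R}$) with $a_j,\lambda_j\in\mathbb{C}$. $\|f\|_{L_2[a,b]}=(\int_a^b|f(t)|^2dt)^{1/2}$. *)

(* Defs.v *)
From Stdlib Require Import Reals.
Open Scope R_scope.

Definition cplx : Type := (R * R)%type.

(* a * e^{lam t} for complex a = ar + i ai, lam = lr + i li, real t: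
   e^{lr t} (cos(li t) + i sin(li t)) (ar + i ai). *)
Definition cexp_term (a lam : cplx) (t : R) : cplx :=
  let ar := fst a in let ai := snd a in
  let lr := fst lam in let li := snd lam in
  (exp (lr * t) * (ar * cos (li * t) - ai * sin (li * t)),
   exp (lr * t) * (ar * sin (li * t) + ai * cos (li * t))).

Fixpoint expsum (n : nat) (a lam : nat -> cplx) (t : R) : cplx :=
  match n with
  | O => (0, 0)
  | S m => let s := expsum m a lam t in
           let u := cexp_term (a m) (lam m) t in
           (fst s + fst u, snd s + snd u)
  end.

Definition cmod2 (z : cplx) : R := fst z ^ 2 + snd z ^ 2.
Definition cmod (z : cplx) : R := sqrt (cmod2 z).

Definition is_integral (g : R -> R) (a b I : R) : Prop :=
  exists pr : Riemann_integrable g a b, RiemannInt pr = I.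

(* Main.v *)
Require Import Defs.
From Stdlib Require Import Reals Lra Lia.
From Coquelicot Require Import Coquelicot.
Open Scope R_scope.

(** Upper bound: let d = min (y - a, b - y) and J = [y - d/2, y + d/2]. The space
    E spanned by the given exponentials is translation invariant, and the
    translate of f in E taking the value f(y) at a point s of J has L2(J)-norm at
    most ||f||. Hence |f(y)|^2 <= K(s) ||f||^2, where K is the diagonal of the
    reproducing kernel of E on J. Averaging over s in J gives
    d |f(y)|^2 <= (int_J K) ||f||^2, and int_J K is at most dim E.

    Lower bound: after an affine change of variable (with a reflection when y is
    closer to b) take y = 0, a = -1, and let f be 2^(-t/2) times the Dirichlet
    sum of the exp(i pi k t), k < n. Then f(0) = n, while the period 2 of the
    Dirichlet sum and the geometric decay give ||f||^2 <= 16 n / 3 however large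
    b is. *)

(** * Continuity and integrals of real functions *)

Lemma continuity_add (f g : R -> R) :
  continuity f -> continuity g -> continuity (fun t => f t + g t).
Proof. exact (continuity_plus f g). Qed.

Lemma continuity_mul (f g : R -> R) :
  continuity f -> continuity g -> continuity (fun t => f t * g t).
Proof. exact (continuity_mult f g). Qed.

Lemma continuity_cst (c : R) : continuity (fun _ => c).
Proof. apply continuity_const; intros s t; reflexivity. Qed.

Lemma continuity_ext (f g : R -> R) :
  (forall t, f t = g t) -> continuity f -> continuity g.
Proof.
intros Hfg Hf t; apply continuity_pt_ext with f; [exact Hfg | exact (Hf t)].
Qed.

Lemma continuity_affine (al be : R) : continuity (fun t => al * t + be).
Proof. intros t; reg. Qed.

Lemma continuity_comp_affine (f : R -> R) (al be : R) :
  continuity f -> continuity (fun t => f (al * t + be)).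
Proof.
intros Hf; exact (continuity_comp _ f (continuity_affine al be) Hf).
Qed.

Ltac solve_continuity :=
  repeat first
    [ assumption | apply continuity_cst | apply continuity_add
    | apply continuity_mul ].

Lemma ex_RInt_continuity (f : R -> R) (a b : R) : continuity f -> ex_RInt f a b.
Proof.
intros Hf; apply (ex_RInt_continuous (V := R_CompleteNormedModule)).
intros z _; apply continuity_pt_filterlim, Hf.
Qed.

(* Coquelicot types equalities between integrals in the carrier of a module
   structure on [R], which [ring] does not recognize. *)
Ltac real_eq := match goal with |- ?x = ?y => change (@eq R x y) end.

Lemma RInt_congr (f g : R -> R) (a b : R) :
  (forall t, Rmin a b < t < Rmax a b -> f t = g t) -> RInt f a b = RInt g a b.
Proof. exact (RInt_ext f g a b). Qed.

Lemma RInt_add (f g : R -> R) (a b : R) : continuity f -> continuity g ->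
  RInt (fun t => f t + g t) a b = RInt f a b + RInt g a b.
Proof.
intros Hf Hg.
exact (RInt_plus f g a b (ex_RInt_continuity _ _ _ Hf) (ex_RInt_continuity _ _ _ Hg)).
Qed.

Lemma RInt_mulc (f : R -> R) (c a b : R) : continuity f ->
  RInt (fun t => c * f t) a b = c * RInt f a b.
Proof.
intros Hf; exact (RInt_scal f a b c (ex_RInt_continuity _ _ _ Hf)).
Qed.

Lemma RInt_cst (c a b : R) : RInt (fun _ => c) a b = c * (b - a).
Proof. rewrite RInt_const; apply Rmult_comm. Qed.

Lemma RInt_split (f : R -> R) (a b c : R) : continuity f ->
  RInt f a c = RInt f a b + RInt f b c.
Proof.
intros Hf; symmetry.
exact (RInt_Chasles f a b c (ex_RInt_continuity _ _ _ Hf) (ex_RInt_continuity _ _ _ Hf)).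
Qed.

Lemma RInt_nonneg (f : R -> R) (a b : R) : a <= b -> continuity f ->
  (forall t, 0 <= f t) -> 0 <= RInt f a b.
Proof.
intros Hab Hf Hp; apply RInt_ge_0; auto using ex_RInt_continuity.
Qed.

Lemma RInt_subset (f : R -> R) (a b c d : R) :
  a <= c -> c <= d -> d <= b -> continuity f -> (forall t, 0 <= f t) ->
  RInt f c d <= RInt f a b.
Proof.
intros Hac Hcd Hdb Hf Hp.
rewrite (RInt_split f a c b Hf), (RInt_split f c d b Hf).
assert (H1 := RInt_nonneg f a c Hac Hf Hp).
assert (H2 := RInt_nonneg f d b Hdb Hf Hp).
lra.
Qed.

(** No sign is imposed on [al]: for a reflection the right-hand integral runs in the opposite
    direction. *)
Lemma RInt_affine (f : R -> R) (al be a b : R) : continuity f ->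
  al * RInt (fun t => f (al * t + be)) a b = RInt f (al * a + be) (al * b + be).
Proof.
intros Hf.
rewrite <- (RInt_comp_lin f al be a b) by now apply ex_RInt_continuity.
symmetry; apply RInt_mulc, continuity_comp_affine, Hf.
Qed.

(** A positive value at [s] would persist on a small interval around [s] inside [[a, b]], whose
    contribution to the integral is positive. *)
Lemma RInt_eq0_inv (f : R -> R) (a b s : R) :
  continuity f -> (forall t, 0 <= f t) -> RInt f a b = 0 -> a < s < b -> f s = 0.
Proof.
intros Hf Hp H0 Hs.
destruct (Rle_lt_or_eq_dec 0 (f s) (Hp s)) as [Hpos | E]; [exfalso | now symmetry].
destruct (Hf s (f s) Hpos) as [e [He Hnear]].
set (h := Rmin (e / 2) (Rmin (s - a) (b - s))).
assert (0 < h) by (repeat apply Rmin_pos; lra).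
assert (h <= e / 2) by apply Rmin_l.
assert (h <= Rmin (s - a) (b - s)) by apply Rmin_r.
assert (Rmin (s - a) (b - s) <= s - a) by apply Rmin_l.
assert (Rmin (s - a) (b - s) <= b - s) by apply Rmin_r.
assert (0 < RInt f (s - h) (s + h)).
{ apply RInt_gt_0; [lra | | intros; apply continuity_pt_filterlim, Hf].
  intros x Hx; destruct (Req_dec x s) as [-> | Hne]; [exact Hpos|].
  assert (Hd : R_dist (f x) (f s) < f s).
  { apply Hnear; split; [split; [exact I | now apply not_eq_sym]|].
    apply Rabs_def1; lra. }
  apply Rabs_def2 in Hd; lra. }
assert (RInt f (s - h) (s + h) <= RInt f a b) by (apply RInt_subset; trivial; lra).
lra.
Qed.

(** * The real inner product on complex-valued functions *)

Definition continuous2 (u : R -> cplx) : Prop :=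
  continuity (fun t => fst (u t)) /\ continuity (fun t => snd (u t)).

Definition dot (z w : cplx) : R := fst z * fst w + snd z * snd w.

Definition axpy (c : R) (u v : R -> cplx) (t : R) : cplx :=
  (c * fst (u t) + fst (v t), c * snd (u t) + snd (v t)).

(* Only the real inner product is needed, with E_n seen as a real space of
   dimension 2n; this is where the factor 2 of the upper bound comes from. *)
Definition ip (a b : R) (u v : R -> cplx) : R := RInt (fun t => dot (u t) (v t)) a b.

Lemma cmod2_dot (z : cplx) : cmod2 z = dot z z.
Proof. unfold cmod2, dot; ring. Qed.

Lemma cmod2_ge0 (z : cplx) : 0 <= cmod2 z.
Proof.
unfold cmod2; assert (H1 := pow2_ge_0 (fst z)); assert (H2 := pow2_ge_0 (snd z)); lra.
Qed.

Lemma continuity_dot (u v : R -> cplx) :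
  continuous2 u -> continuous2 v -> continuity (fun t => dot (u t) (v t)).
Proof. intros [] []; unfold dot; solve_continuity. Qed.

Lemma continuity_cmod2 (u : R -> cplx) :
  continuous2 u -> continuity (fun t => cmod2 (u t)).
Proof.
intros Hu; apply (continuity_ext (fun t => dot (u t) (u t))).
- intros t; symmetry; apply cmod2_dot.
- now apply continuity_dot.
Qed.

Lemma continuous2_axpy (c : R) (u v : R -> cplx) :
  continuous2 u -> continuous2 v -> continuous2 (axpy c u v).
Proof. intros [] []; split; simpl; solve_continuity. Qed.

Lemma continuous2_ext (u v : R -> cplx) :
  (forall t, u t = v t) -> continuous2 u -> continuous2 v.
Proof.
intros E [H1 H2]; split; [eapply continuity_ext, H1 | eapply continuity_ext, H2];
  intros t; simpl; now rewrite E.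
Qed.

Section InnerProduct.
Variables a b : R.

Lemma ip_sym (u v : R -> cplx) : ip a b u v = ip a b v u.
Proof. apply RInt_congr; intros t _; unfold dot; ring. Qed.

Lemma ip_ext (u u' v v' : R -> cplx) :
  (forall t, u t = u' t) -> (forall t, v t = v' t) -> ip a b u v = ip a b u' v'.
Proof. intros Eu Ev; apply RInt_congr; intros t _; now rewrite Eu, Ev. Qed.

Lemma ip_axpyl (c : R) (u v w : R -> cplx) :
  continuous2 u -> continuous2 v -> continuous2 w ->
  ip a b (axpy c u v) w = c * ip a b u w + ip a b v w.
Proof.
intros Hu Hv Hw; unfold ip.
rewrite <- RInt_mulc, <- RInt_add by auto using continuity_mul, continuity_cst, continuity_dot.
apply RInt_congr; intros t _; unfold dot; simpl; ring.
Qed.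

Lemma ip_axpyr (c : R) (u v w : R -> cplx) :
  continuous2 u -> continuous2 v -> continuous2 w ->
  ip a b w (axpy c u v) = c * ip a b w u + ip a b w v.
Proof. intros; rewrite ip_sym, ip_axpyl, !(ip_sym w); trivial. Qed.

Lemma ip_cmod2 (u : R -> cplx) : ip a b u u = RInt (fun t => cmod2 (u t)) a b.
Proof. apply RInt_congr; intros t _; symmetry; apply cmod2_dot. Qed.

Hypothesis hab : a < b.

Lemma ip_ge0 (u : R -> cplx) : continuous2 u -> 0 <= ip a b u u.
Proof.
intros Hu; rewrite ip_cmod2; apply RInt_nonneg;
  auto using cmod2_ge0, continuity_cmod2, Rlt_le.
Qed.

Lemma ip_eq0_inv (u : R -> cplx) (s : R) :
  continuous2 u -> ip a b u u = 0 -> a < s < b -> u s = (0, 0).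
Proof.
intros Hu H0 Hs; rewrite ip_cmod2 in H0.
assert (E : cmod2 (u s) = 0)
  by (apply (RInt_eq0_inv (fun t => cmod2 (u t)) a b);
      auto using continuity_cmod2, cmod2_ge0).
unfold cmod2 in E; destruct (u s) as [x z]; simpl in E.
f_equal; nra.
Qed.

(* [V] is a space of functions admitting orthogonal projections and a bound
   [k] of trace at most [N] for the diagonal of its reproducing kernel on [a, b]. *)
Definition kernel_space (V : (R -> cplx) -> Prop) (N : R) : Prop :=
  (forall g, V g -> continuous2 g) /\
  (forall c f g, V f -> V g -> V (axpy c f g)) /\
  (forall u, continuous2 u ->
     exists p, V p /\ forall g, V g -> ip a b u g = ip a b p g) /\
  (exists k, continuity k /\ (forall t, 0 <= k t) /\ RInt k a b <= N /\
     forall g s, V g -> a < s < b -> cmod2 (g s) <= k s * ip a b g g).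

(** * Kernel bounds when one generator is added *)

Definition adjoin (V : (R -> cplx) -> Prop) (phi : R -> cplx) (g : R -> cplx) : Prop :=
  exists c g0, V g0 /\ forall t, g t = axpy c phi g0 t.

(** Cauchy-Schwarz in the plane for the vectors [(|w| / sqrt q, sqrt k)] and [(|c| sqrt q, sqrt G)],
    whose scalar product dominates [|c w + z|]. *)
Lemma cauchy_schwarz_step (k G c q : R) (z w : cplx) :
  0 <= k -> 0 <= G -> 0 < q -> cmod2 z <= k * G ->
  cmod2 (c * fst w + fst z, c * snd w + snd z)
    <= (/ q * cmod2 w + k) * (G + c ^ 2 * q).
Proof.
intros Hk HG Hq Hz.
set (W := cmod2 w) in *; set (Z := cmod2 z) in *.
assert (HW : 0 <= W) by apply cmod2_ge0.
assert (HZ : 0 <= Z) by apply cmod2_ge0.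
set (D := c * dot w z).
assert (E : cmod2 (c * fst w + fst z, c * snd w + snd z) = c ^ 2 * W + 2 * D + Z)
  by (unfold W, Z, D, cmod2, dot; simpl; ring).
assert (HD : D ^ 2 <= c ^ 2 * W * Z).
{ assert (Hs : c ^ 2 * W * Z - D ^ 2 = (c * (fst w * snd z - snd w * fst z)) ^ 2)
    by (unfold W, Z, D, cmod2, dot; ring).
  assert (Hp := pow2_ge_0 (c * (fst w * snd z - snd w * fst z))); lra. }
assert (Hiq : 0 < / q) by now apply Rinv_0_lt_compat.
set (A := / q * W * G); set (B := k * (c ^ 2 * q)).
assert (Hc := pow2_ge_0 c).
assert (HA : 0 <= A) by (unfold A; repeat apply Rmult_le_pos; lra).
assert (HB : 0 <= B) by (apply Rmult_le_pos, Rmult_le_pos; lra).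
assert (HAB : D ^ 2 <= A * B).
{ replace (A * B) with (c ^ 2 * W * (k * G)) by (unfold A, B; field; lra).
  apply Rle_trans with (1 := HD); apply Rmult_le_compat_l; trivial.
  now apply Rmult_le_pos. }
(* AM-GM: [4 D^2 <= 4 A B <= (A + B)^2]. *)
assert (2 * D <= A + B).
{ assert (Hp := pow2_ge_0 (A - B)).
  apply Rsqr_incr_0_var; [unfold Rsqr; lra | lra]. }
rewrite E.
replace ((/ q * W + k) * (G + c ^ 2 * q)) with (c ^ 2 * W + (A + B) + k * G)
  by (unfold A, B; field; lra).
lra.
Qed.

(** A Gram-Schmidt step. Let [r] be the component of [phi] orthogonal to [V] and [q] its squared
    norm. If [q > 0], the kernel gains the term [|r|^2 / q], whose integral is 1. If [q = 0], then
    [r] vanishes on [(a, b)] and the old bound still works. *)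
Lemma kernel_space_adjoin (V : (R -> cplx) -> Prop) (phi : R -> cplx) (N : R) :
  continuous2 phi -> kernel_space V N -> kernel_space (adjoin V phi) (N + 1).
Proof.
intros Hphi (HVc & HVl & HVp & k & Hkc & Hk0 & HkN & Hk).
destruct (HVp phi Hphi) as [p [Vp Hp]].
assert (Hpc := HVc p Vp).
set (r := axpy (-1) p phi).
assert (Hr : continuous2 r) by now apply continuous2_axpy.
assert (Hrg : forall g, V g -> ip a b r g = 0).
{ intros g Vg; unfold r; rewrite ip_axpyl, (Hp g Vg) by auto; ring. }
(* Since [phi = r + p], the sum [c phi + g0] equals [c r + (c p + g0)]. *)
assert (Hdec : forall g, adjoin V phi g ->
          exists c g1, V g1 /\ forall t, g t = axpy c r g1 t).
{ intros g (c & g0 & Vg0 & E); exists c, (axpy c p g0); split; [auto|].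
  intros t; rewrite E; unfold r, axpy; simpl; f_equal; ring. }
set (q := ip a b r r).
assert (Hq0 : 0 <= q) by now apply ip_ge0.
(* Pythagoras for the orthogonal decomposition. *)
assert (Hgg : forall g c g1, V g1 -> (forall t, g t = axpy c r g1 t) ->
          ip a b g g = ip a b g1 g1 + c ^ 2 * q).
{ intros g c g1 Vg1 E; assert (H1 := HVc g1 Vg1).
  rewrite (ip_ext g (axpy c r g1) g (axpy c r g1)) by assumption.
  rewrite ip_axpyl, !ip_axpyr by (auto; now apply continuous2_axpy).
  rewrite (ip_sym g1 r), (Hrg g1 Vg1); unfold q; ring. }
assert (Hz : q = 0 -> forall s, a < s < b -> r s = (0, 0))
  by (intros Eq s Hs; now apply ip_eq0_inv).
split; [|split; [|split]].
- intros g (c & g0 & Vg0 & E).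
  apply continuous2_ext with (axpy c phi g0); [now intros; rewrite E|].
  apply continuous2_axpy; auto.
- intros d f g (cf & f0 & Vf & Ef) (cg & g0 & Vg & Eg).
  exists (d * cf + cg), (axpy d f0 g0); split; [auto|].
  intros t; unfold axpy in *; rewrite Ef, Eg; simpl; f_equal; ring.
- intros u Hu; destruct (HVp u Hu) as [p1 [Vp1 Hp1]].
  assert (Hp1c := HVc p1 Vp1).
  (* The coefficient of the projection of [u] onto [r]. The identity [ip a b u r = d * q] survives
     [q = 0], because [r] then vanishes on [(a, b)]. *)
  set (d := ip a b u r / q).
  exists (axpy d r p1); split.
  + exists d, (axpy (- d) p p1); split; [auto|].
    intros t; unfold r, axpy; simpl; f_equal; ring.
  + intros g Vg; destruct (Hdec g Vg) as (c & g1 & Vg1 & E).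
    assert (H1 := HVc g1 Vg1).
    rewrite (ip_ext u u g (axpy c r g1)), (ip_ext (axpy d r p1) (axpy d r p1) g (axpy c r g1))
      by auto.
    rewrite ip_axpyl, !ip_axpyr by (auto; now apply continuous2_axpy).
    rewrite (Hp1 g1 Vg1), (Hrg g1 Vg1), (ip_sym p1 r), (Hrg p1 Vp1).
    fold q; assert (Hd : ip a b u r = d * q).
    { destruct (Req_dec q 0) as [Eq | Nq]; [|unfold d; field; exact Nq].
      rewrite Eq, Rmult_0_r; transitivity (RInt (fun _ => 0) a b);
        [|rewrite RInt_cst; ring].
      apply RInt_congr; intros s; rewrite Rmin_left, Rmax_right by lra; intros Hs.
      rewrite (Hz Eq s Hs); unfold dot; simpl; ring. }
    rewrite Hd; ring.
(* By the convention [/ 0 = 0], this is just [k] in the degenerate case [q = 0]. *)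
- exists (fun t => / q * cmod2 (r t) + k t); repeat split.
  + auto using continuity_add, continuity_mul, continuity_cst, continuity_cmod2.
  + intros t; assert (Hc := cmod2_ge0 (r t)); specialize (Hk0 t).
    assert (0 <= / q)
      by (destruct Hq0 as [Hq0 | <-];
          [now apply Rlt_le, Rinv_0_lt_compat | rewrite Rinv_0; lra]).
    assert (0 <= / q * cmod2 (r t)) by now apply Rmult_le_pos. lra.
  + rewrite RInt_add, RInt_mulc, <- ip_cmod2
      by auto using continuity_mul, continuity_cst, continuity_cmod2.
    fold q; destruct (Req_dec q 0) as [Eq | Nq]; [rewrite Eq; lra|].
    rewrite Rinv_l by exact Nq; lra.
  + intros g s Vg Hs; destruct (Hdec g Vg) as (c & g1 & Vg1 & E).
    rewrite (Hgg g c g1 Vg1 E), E.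
    assert (Hb := Hk g1 s Vg1 Hs).
    assert (HG := ip_ge0 g1 (HVc g1 Vg1)).
    destruct (Req_dec q 0) as [Eq | Nq].
    * rewrite Eq; unfold axpy; rewrite (Hz Eq s Hs).
      replace (cmod2 (0, 0)) with 0 by (unfold cmod2; simpl; ring).
      simpl; rewrite !Rmult_0_r, !Rplus_0_l, !Rplus_0_r, <- surjective_pairing.
      exact Hb.
    * apply cauchy_schwarz_step; auto; lra.
Qed.

Definition zero_space (g : R -> cplx) : Prop := forall t, g t = (0, 0).

Lemma kernel_space_zero : kernel_space zero_space 0.
Proof.
assert (H0 : continuous2 (fun _ => (0, 0))) by (split; simpl; solve_continuity).
split; [|split; [|split]].
- intros g Hg; apply continuous2_ext with (2 := H0); now intros t; rewrite Hg.
- intros c f g Hf Hg t; unfold axpy; rewrite Hf, Hg; simpl; f_equal; ring.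
- intros u Hu; exists (fun _ => (0, 0)); split; [now intros t|].
  intros g Hg; apply RInt_congr; intros t _; rewrite Hg; unfold dot; simpl; ring.
- exists (fun _ => 0); repeat split; [solve_continuity | intros; lra | |].
  + rewrite RInt_cst; lra.
  + intros g s Hg _; rewrite Hg; unfold cmod2; simpl; lra.
Qed.

(** * Exponential sums and the upper bound *)

(** Over real scalars each frequency needs two generators, with coefficients 1 and i. *)
Fixpoint exp_space (lam : nat -> cplx) (n : nat) : (R -> cplx) -> Prop :=
  match n with
  | O => zero_space
  | S m => adjoin (adjoin (exp_space lam m) (cexp_term (1, 0) (lam m)))
             (cexp_term (0, 1) (lam m))
  end.

Lemma continuous2_cexp_term (al lam : cplx) : continuous2 (cexp_term al lam).
Proof. split; intros t; simpl; reg. Qed.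

Lemma kernel_space_exp (lam : nat -> cplx) (n : nat) :
  kernel_space (exp_space lam n) (2 * INR n).
Proof.
induction n as [|n IH].
- simpl INR; rewrite Rmult_0_r; exact kernel_space_zero.
- rewrite S_INR; replace (2 * (INR n + 1)) with (2 * INR n + 1 + 1) by ring.
  repeat apply kernel_space_adjoin; auto using continuous2_cexp_term.
Qed.

Lemma expsum_exp_space (al lam : nat -> cplx) (n : nat) :
  exp_space lam n (expsum n al lam).
Proof.
induction n as [|n IH]; [now intros t|].
exists (snd (al n)), (axpy (fst (al n)) (cexp_term (1, 0) (lam n)) (expsum n al lam)).
split; [now exists (fst (al n)), (expsum n al lam)|].
intros t; unfold axpy, cexp_term; simpl; f_equal; ring.
Qed.

(** The bound [k] is chosen before the coefficients [al], so a single [k] serves all translates of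
    an exponential sum. *)
Lemma expsum_kernel (lam : nat -> cplx) (n : nat) :
  exists k, continuity k /\ (forall t, 0 <= k t) /\ RInt k a b <= 2 * INR n /\
    forall al s, a < s < b ->
      cmod2 (expsum n al lam s) <= k s * RInt (fun t => cmod2 (expsum n al lam t)) a b.
Proof.
destruct (kernel_space_exp lam n) as (_ & _ & _ & k & Hkc & Hk0 & HkN & Hk).
exists k; repeat split; trivial.
intros al s Hs; rewrite <- ip_cmod2; apply Hk; trivial; apply expsum_exp_space.
Qed.
End InnerProduct.

Lemma continuous2_expsum (al lam : nat -> cplx) (n : nat) :
  continuous2 (expsum n al lam).
Proof.
induction n as [|n IH]; [split; simpl; solve_continuity|].
destruct IH; destruct (continuous2_cexp_term (al n) (lam n)).
split; simpl; solve_continuity.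
Qed.

(** The constant factor [e^{lam y}] is absorbed into the coefficient. The case [x = 1] is
    translation invariance; other values of [x] rescale the extremal function. *)
Lemma expsum_affine (al lam : nat -> cplx) (n : nat) (x y t : R) :
  expsum n al lam (x * t + y) =
  expsum n (fun k => cexp_term (al k) (lam k) y)
    (fun k => (x * fst (lam k), x * snd (lam k))) t.
Proof.
induction n as [|n IH]; [reflexivity|].
simpl; rewrite IH; unfold cexp_term; simpl.
rewrite !Rmult_plus_distr_l, exp_plus, cos_plus, sin_plus.
rewrite <- !Rmult_assoc, !(Rmult_comm _ x).
f_equal; ring.
Qed.

Lemma expsum_upper (a b y : R) (n : nat) (al lam : nat -> cplx) :
  a < y -> y < b ->
  cmod2 (expsum n al lam y)
    <= 2 * INR n / Rmin (y - a) (b - y) * RInt (fun t => cmod2 (expsum n al lam t)) a b.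
Proof.
intros Hay Hyb.
set (d := Rmin (y - a) (b - y)).
assert (Hd : 0 < d) by (apply Rmin_pos; lra).
assert (Hda : d <= y - a) by apply Rmin_l.
assert (Hdb : d <= b - y) by apply Rmin_r.
set (f := expsum n al lam).
set (I := RInt (fun t => cmod2 (f t)) a b).
assert (Hf : continuity (fun t => cmod2 (f t)))
  by apply continuity_cmod2, continuous2_expsum.
assert (Hf0 : forall t, 0 <= cmod2 (f t)) by (intros; apply cmod2_ge0).
(* For [s] in [(l, r)], moving [[l, r]] by [y - s] keeps it inside [[y - d, y + d]], hence inside
   [[a, b]]. *)
set (l := y - d / 2); set (r := y + d / 2).
assert (Hlr : l < r) by (unfold l, r; lra).
(* The factors 1 make the frequencies match [expsum_affine] at [x = 1] literally. *)
destruct (expsum_kernel l r Hlr (fun k => (1 * fst (lam k), 1 * snd (lam k))) n)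
  as (k & Hkc & Hk0 & HkN & Hk).
assert (HI : 0 <= I) by (apply RInt_nonneg; auto; lra).
assert (Hpt : forall s, l < s < r -> cmod2 (f y) <= I * k s).
{ intros s Hs.
  (* The translate of [f] taking the value [f y] at [s]. *)
  set (g := fun t => f (1 * t + (y - s))).
  assert (Hg : forall t, g t = expsum n (fun j => cexp_term (al j) (lam j) (y - s))
                 (fun k => (1 * fst (lam k), 1 * snd (lam k))) t)
    by (intros t; apply expsum_affine).
  assert (Hks := Hk (fun j => cexp_term (al j) (lam j) (y - s)) s Hs).
  rewrite <- Hg in Hks.
  rewrite (RInt_congr _ (fun t => cmod2 (g t))) in Hks by (intros; now rewrite Hg).
  assert (Eg : g s = f y) by (unfold g; f_equal; ring).
  rewrite Eg in Hks; rewrite Rmult_comm.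
  apply Rle_trans with (1 := Hks); apply Rmult_le_compat_l; [apply Hk0|].
  rewrite <- (Rmult_1_l (RInt _ l r)).
  unfold g; rewrite (RInt_affine (fun t => cmod2 (f t)) 1 (y - s) l r Hf).
  unfold l, r in *; apply RInt_subset; trivial; lra. }
(* Integrate the pointwise bound over [s]; its left side is constant. *)
assert (Hint : cmod2 (f y) * (r - l) <= I * RInt k l r).
{ rewrite <- RInt_cst, <- RInt_mulc by exact Hkc.
  apply RInt_le; [lra | | | exact Hpt]; apply ex_RInt_continuity;
    auto using continuity_mul, continuity_cst. }
replace (r - l) with d in Hint by (unfold r, l; field).
assert (I * RInt k l r <= I * (2 * INR n)) by now apply Rmult_le_compat_l.
apply Rmult_le_reg_r with d; [exact Hd|].
replace (2 * INR n / d * I * d) with (I * (2 * INR n)) by (field; lra).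
lra.
Qed.

(** * The damped Dirichlet sum *)

Definition unit_frequencies (rho : R) (k : nat) : cplx := (rho, PI * INR k).

Definition dirichlet (rho : R) (n : nat) : R -> cplx :=
  expsum n (fun _ => (1, 0)) (unit_frequencies rho).

Lemma dirichlet_damped (rho : R) (n : nat) (t : R) :
  dirichlet rho n t =
  (exp (rho * t) * fst (dirichlet 0 n t), exp (rho * t) * snd (dirichlet 0 n t)).
Proof.
unfold dirichlet; induction n as [|n IH]; simpl.
- f_equal; ring.
- rewrite IH; simpl; rewrite (Rmult_0_l t), exp_0; f_equal; ring.
Qed.

Lemma cmod2_dirichlet_damped (rho : R) (n : nat) (t : R) :
  cmod2 (dirichlet rho n t) = exp (2 * rho * t) * cmod2 (dirichlet 0 n t).
Proof.
rewrite dirichlet_damped; unfold cmod2; simpl.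
replace (2 * rho * t) with (rho * t + rho * t) by ring; rewrite exp_plus; ring.
Qed.

Lemma dirichlet_at0 (rho : R) (n : nat) : dirichlet rho n 0 = (INR n, 0).
Proof.
unfold dirichlet; induction n as [|n IH]; [reflexivity|].
rewrite S_INR; simpl; rewrite IH; simpl.
rewrite !Rmult_0_r, exp_0, cos_0, sin_0; f_equal; ring.
Qed.

Lemma dirichlet_periodic (n : nat) (t : R) : dirichlet 0 n (t + 2) = dirichlet 0 n t.
Proof.
unfold dirichlet; induction n as [|n IH]; [reflexivity|].
simpl; rewrite IH; unfold unit_frequencies; simpl.
replace (PI * INR n * (t + 2)) with (PI * INR n * t + 2 * INR n * PI) by ring.
rewrite cos_period, sin_period, !Rmult_0_l; reflexivity.
Qed.

Lemma RInt_cos_full_period (m : nat) : (0 < m)%nat ->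
  RInt (fun t => cos (PI * INR m * t)) (-1) 1 = 0.
Proof.
intros Hm; assert (Hm' := lt_0_INR m Hm); assert (Hpi := PI_RGT_0).
assert (Hw : PI * INR m <> 0) by nra.
apply is_RInt_unique.
replace 0 with (minus (sin (PI * INR m * 1) / (PI * INR m))
                  (sin (PI * INR m * (-1)) / (PI * INR m))).
- apply (is_RInt_derive (fun t => sin (PI * INR m * t) / (PI * INR m))).
  + intros t _; auto_derive; [trivial|].
    real_eq; field; lra.
  + intros t _; apply continuity_pt_filterlim; reg.
- replace (PI * INR m * 1) with (- (PI * INR m) + 2 * INR m * PI) by ring.
  rewrite sin_period; replace (PI * INR m * -1) with (- (PI * INR m)) by ring.
  apply (Rminus_diag_eq _ _ eq_refl).
Qed.

(** Each term of index [k < n] contributes [cos (PI (m - k) t)] with [m - k > 0], which integrates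
    to 0 over full periods. *)
Lemma RInt_cross_dirichlet (n m : nat) : (n <= m)%nat ->
  RInt (fun t => dot (dirichlet 0 n t) (cexp_term (1, 0) (unit_frequencies 0 m) t)) (-1) 1 = 0.
Proof.
unfold dirichlet; induction n as [|n IH]; intros Hnm.
- rewrite (RInt_congr _ (fun _ => 0)); [rewrite RInt_cst; real_eq; ring|].
  intros t _; unfold dot; simpl; ring.
- rewrite (RInt_congr _ (fun t =>
    dot (dirichlet 0 n t) (cexp_term (1, 0) (unit_frequencies 0 m) t)
    + cos (PI * INR (m - n) * t))).
  + rewrite RInt_add.
    * unfold dirichlet; rewrite IH, RInt_cos_full_period by lia; real_eq; ring.
    * apply continuity_dot; [apply continuous2_expsum | apply continuous2_cexp_term].
    * intros t; reg.
  + intros t _; rewrite minus_INR by lia.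
    replace (PI * (INR m - INR n) * t) with (PI * INR m * t - PI * INR n * t) by ring.
    rewrite cos_minus; unfold dot; simpl; rewrite (Rmult_0_l t), exp_0.
    unfold dirichlet; ring.
Qed.

(** Parseval: the terms are orthogonal on [[-1, 1]], each of squared norm 2. *)
Lemma RInt_dirichlet (n : nat) :
  RInt (fun t => cmod2 (dirichlet 0 n t)) (-1) 1 = 2 * INR n.
Proof.
induction n as [|n IH].
- rewrite (RInt_congr _ (fun _ => 0)); [rewrite RInt_cst; real_eq; simpl; ring|].
  intros t _; unfold cmod2; simpl; ring.
- rewrite (RInt_congr _ (fun t => cmod2 (dirichlet 0 n t) +
    (2 * dot (dirichlet 0 n t) (cexp_term (1, 0) (unit_frequencies 0 n) t) + 1))).
  + assert (Hc : continuity (fun t =>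
        dot (dirichlet 0 n t) (cexp_term (1, 0) (unit_frequencies 0 n) t)))
      by (apply continuity_dot; [apply continuous2_expsum | apply continuous2_cexp_term]).
    assert (Hd : continuity (fun t => cmod2 (dirichlet 0 n t)))
      by apply continuity_cmod2, continuous2_expsum.
    rewrite RInt_add, RInt_add, RInt_mulc, RInt_cst, IH, RInt_cross_dirichlet, S_INR
      by (trivial; solve_continuity).
    real_eq; ring.
  + intros t _; unfold cmod2, dot, dirichlet; simpl.
    assert (Hsc := sin2_cos2 (PI * INR n * t)); unfold Rsqr in Hsc.
    rewrite (Rmult_0_l t), exp_0; lra.
Qed.

Lemma exp_ln2_mul (x : R) : exp (- ln 2 * (x + 2)) = exp (- ln 2 * x) / 4.
Proof.
replace (- ln 2 * (x + 2)) with (- ln 2 * x + - (ln 2 + ln 2)) by ring.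
rewrite exp_plus, exp_Ropp, exp_plus, exp_ln by lra; field.
Qed.

(* The integral F(T) over [-1, T] satisfies F(T + 2) <= 4 n + F(T) / 4. *)
Lemma RInt_damped_dirichlet_odd (n N : nat) :
  RInt (fun t => cmod2 (dirichlet (- ln 2 / 2) n t)) (-1) (2 * INR N - 1) <= 16 * INR n / 3.
Proof.
set (w := fun t => cmod2 (dirichlet (- ln 2 / 2) n t)).
assert (Hn := pos_INR n).
assert (Hw : continuity w) by apply continuity_cmod2, continuous2_expsum.
assert (E : forall t, w t = exp (- ln 2 * t) * cmod2 (dirichlet 0 n t))
  by (intros t; unfold w; rewrite cmod2_dirichlet_damped; do 2 f_equal; field).
induction N as [|N IH].
- simpl; replace (2 * 0 - 1) with (-1) by ring.
  rewrite (RInt_point (V := R_CompleteNormedModule)); unfold zero; simpl; lra.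
- rewrite S_INR, (RInt_split w (-1) 1) by exact Hw.
  (* The weight [2^(-t)] is at most 2 on [[-1, 1]]. *)
  assert (H1 : RInt w (-1) 1 <= 2 * (2 * INR n)).
  { rewrite <- RInt_dirichlet, <- RInt_mulc by apply continuity_cmod2, continuous2_expsum.
    apply RInt_le; [lra | now apply ex_RInt_continuity | |].
    - apply ex_RInt_continuity, continuity_mul;
        [apply continuity_cst | apply continuity_cmod2, continuous2_expsum].
    - intros t Ht; rewrite E; apply Rmult_le_compat_r; [apply cmod2_ge0|].
      assert (Hl := ln_lt_2).
      apply Rle_trans with (exp (ln 2)); [|rewrite exp_ln; lra].
      destruct (Req_dec (- ln 2 * t) (ln 2)) as [->|]; [lra|].
      apply Rlt_le, exp_increasing; nra. }
  (* A shift by the period 2 preserves the Dirichlet sum and divides the weight by 4. *)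
  assert (H2 : RInt w 1 (2 * (INR N + 1) - 1) = RInt w (-1) (2 * INR N - 1) / 4).
  { replace 1 with (1 * -1 + 2) at 1 by ring.
    replace (2 * (INR N + 1) - 1) with (1 * (2 * INR N - 1) + 2) by ring.
    rewrite <- (RInt_affine w 1 2) by exact Hw; rewrite Rmult_1_l.
    transitivity (/ 4 * RInt w (-1) (2 * INR N - 1)); [|real_eq; field].
    rewrite <- RInt_mulc by exact Hw.
    apply RInt_congr; intros t _.
    rewrite !E, Rmult_1_l, dirichlet_periodic, exp_ln2_mul; field. }
  (* The bound [16 n / 3] is the fixed point of [F = 4 n + F / 4]. *)
  rewrite H2; lra.
Qed.

Lemma RInt_damped_dirichlet (n : nat) (T : R) : -1 <= T ->
  RInt (fun t => cmod2 (dirichlet (- ln 2 / 2) n t)) (-1) T <= 16 * INR n / 3.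
Proof.
intros HT; destruct (INR_unbounded (T + 1)) as [N HN].
apply Rle_trans with (2 := RInt_damped_dirichlet_odd n N).
apply RInt_subset; [lra | lra | | apply continuity_cmod2, continuous2_expsum
  | intros; apply cmod2_ge0].
assert (H := pos_INR N); lra.
Qed.

(** * The extremal function on [[a, b]] *)

Lemma expsum_extremal (a b y : R) (n : nat) : a < y -> y < b ->
  exists al lam, expsum n al lam y = (INR n, 0) /\
    RInt (fun t => cmod2 (expsum n al lam t)) a b
      <= Rmin (y - a) (b - y) * (16 * INR n / 3).
Proof.
intros Hay Hyb.
set (d := Rmin (y - a) (b - y)).
assert (Hd : 0 < d) by (apply Rmin_pos; lra).
set (g := dirichlet (- ln 2 / 2) n).
assert (Hg : continuity (fun t => cmod2 (g t)))
  by apply continuity_cmod2, continuous2_expsum.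
(* The sign [be] is 1 or -1, chosen so that [t -> be (t - y) / d] sends the endpoint nearer to [y]
   to -1; the factor [d] is the Jacobian. *)
assert (Hal : exists be,
   RInt (fun t => cmod2 (g (be / d * t + - (be / d * y)))) a b <= d * (16 * INR n / 3)).
{ destruct (Rle_lt_dec (y - a) (b - y)) as [Hle | Hlt].
  - exists 1.
    assert (Ed : d = y - a) by now apply Rmin_left.
    apply Rmult_le_reg_l with (/ d); [now apply Rinv_0_lt_compat|].
    rewrite <- (Rmult_assoc (/ d) d), Rinv_l, Rmult_1_l by lra.
    replace (/ d) with (1 / d) at 1 by (field; lra).
    rewrite (RInt_affine (fun t => cmod2 (g t)) (1 / d) (- (1 / d * y)) a b Hg).
    replace (1 / d * a + - (1 / d * y)) with (-1) by (rewrite Ed; field; lra).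
    apply RInt_damped_dirichlet.
    replace (1 / d * b + - (1 / d * y)) with ((b - y) / d) by (field; lra).
    assert (0 < (b - y) / d) by (apply Rdiv_lt_0_compat; lra); lra.
  - exists (-1).
    assert (Ed : d = b - y) by (apply Rmin_right; lra).
    apply Rmult_le_reg_l with (/ d); [now apply Rinv_0_lt_compat|].
    rewrite <- (Rmult_assoc (/ d) d), Rinv_l, Rmult_1_l by lra.
    replace (/ d) with (- (-1 / d)) at 1 by (field; lra).
    rewrite Ropp_mult_distr_l_reverse,
      (RInt_affine (fun t => cmod2 (g t)) (-1 / d) (- (-1 / d * y)) a b Hg).
    replace (-1 / d * b + - (-1 / d * y)) with (-1) by (rewrite Ed; field; lra).
    replace (-1 / d * a + - (-1 / d * y)) with ((y - a) / d) by (field; lra).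
    assert (0 < (y - a) / d) by (apply Rdiv_lt_0_compat; lra).
    (* The reflection reversed the bounds; splitting the zero integral from -1 to -1 turns them
       back. *)
    assert (Hsw := RInt_split (fun t => cmod2 (g t)) (-1) ((y - a) / d) (-1) Hg).
    rewrite (RInt_point (V := R_CompleteNormedModule)) in Hsw; unfold zero in Hsw; simpl in Hsw.
    assert (Hb := RInt_damped_dirichlet n ((y - a) / d)).
    fold g in Hb; lra. }
destruct Hal as [be HI].
exists (fun k => cexp_term (1, 0) (unit_frequencies (- ln 2 / 2) k) (- (be / d * y))),
  (fun k => (be / d * fst (unit_frequencies (- ln 2 / 2) k),
             be / d * snd (unit_frequencies (- ln 2 / 2) k))).
assert (E := expsum_affine (fun _ => (1, 0)) (unit_frequencies (- ln 2 / 2)) n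
               (be / d) (- (be / d * y))).
split.
- rewrite <- E, Rplus_opp_r; apply dirichlet_at0.
- erewrite RInt_congr; [exact HI|].
  intros t _; simpl; rewrite <- E; reflexivity.
Qed.

(** * Transfer to Riemann integrals and conclusion *)

Lemma is_integral_RInt (g : R -> R) (a b I : R) : is_integral g a b I -> RInt g a b = I.
Proof. intros [pr <-]; apply RInt_Reals. Qed.

Lemma is_integral_continuity (g : R -> R) (a b : R) :
  continuity g -> is_integral g a b (RInt g a b).
Proof.
intros Hg; exists (ex_RInt_Reals_0 g a b (ex_RInt_continuity g a b Hg)).
symmetry; apply RInt_Reals.
Qed.

Theorem theorem7p1 (a b y : R) (n : nat)
  (hab : a < b) (hy1 : a < y) (hy2 : y < b) (hn : (2 <= n)%nat) :
  (* lower bound: sup_{f <> 0} |f(y)| / ||f||_{L2[a,b]} >= L *)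
  (forall c : R,
     c < sqrt ((INR n - 2) * ln 2 / (32 * Rmin (y - a) (b - y))) ->
     exists (al lam : nat -> cplx) (I : R),
       (exists t : R, cmod (expsum n al lam t) <> 0) /\
       is_integral (fun t => cmod2 (expsum n al lam t)) a b I /\
       c * sqrt I < cmod (expsum n al lam y))
  /\
  (* upper bound: every nonzero f in E_n has |f(y)| <= U ||f||_{L2[a,b]} *)
  (forall (al lam : nat -> cplx) (I : R),
     (exists t : R, cmod (expsum n al lam t) <> 0) ->
     is_integral (fun t => cmod2 (expsum n al lam t)) a b I ->
     cmod (expsum n al lam y) <=
       sqrt (2 * INR n / Rmin (y - a) (b - y)) * sqrt I).
Proof.
set (d := Rmin (y - a) (b - y)).
assert (Hd : 0 < d) by (apply Rmin_pos; lra).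
assert (Hn : 2 <= INR n) by (apply (le_INR 2); exact hn).
split.
- intros c Hc.
  destruct (expsum_extremal a b y n hy1 hy2) as (al & lam & Ey & HI); fold d in HI.
  set (I := RInt (fun t => cmod2 (expsum n al lam t)) a b) in HI.
  assert (Hf : continuity (fun t => cmod2 (expsum n al lam t)))
    by apply continuity_cmod2, continuous2_expsum.
  assert (Em : cmod (expsum n al lam y) = INR n).
  { rewrite Ey; unfold cmod, cmod2; simpl fst; simpl snd.
    replace (INR n ^ 2 + 0 ^ 2) with (INR n ^ 2) by ring.
    apply sqrt_pow2; lra. }
  exists al, lam, I; split; [exists y; lra | split].
  + now apply is_integral_continuity.
  + rewrite Em.
    set (L := (INR n - 2) * ln 2 / (32 * d)) in *.
    assert (Hl1 : ln 2 <= 1).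
    { rewrite <- (ln_exp 1); assert (He := exp_ineq1 1); apply Rlt_le, ln_increasing; lra. }
    assert (Hl0 := ln_lt_2).
    assert (HI0 : 0 <= I) by (apply RInt_nonneg; [lra | exact Hf | intros; apply cmod2_ge0]).
    assert (HL0 : 0 <= L).
    { unfold L; apply Rmult_le_pos; [nra|].
      apply Rlt_le, Rinv_0_lt_compat; lra. }
    apply Rle_lt_trans with (sqrt L * sqrt I).
    { apply Rmult_le_compat_r; [apply sqrt_pos | lra]. }
    rewrite <- sqrt_mult_alt by exact HL0.
    rewrite <- (sqrt_pow2 (INR n)) by lra.
    apply sqrt_lt_1_alt; split; [now apply Rmult_le_pos|].
    (* After squaring, the goal is [L * I < n^2]. The bound on [I] reduces it to
       [(n - 2) n ln 2 / 6 < n^2], which follows from [ln 2 <= 1]. *)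
    apply Rle_lt_trans with (L * (d * (16 * INR n / 3))).
    { now apply Rmult_le_compat_l. }
    replace (L * (d * (16 * INR n / 3))) with ((INR n - 2) * ln 2 * INR n / 6)
      by (unfold L; field; lra).
    nra.
- intros al lam I _ HI; apply is_integral_RInt in HI; subst I.
  unfold cmod at 1; rewrite <- sqrt_mult_alt.
  + apply sqrt_le_1_alt; now apply expsum_upper.
  + apply Rlt_le, Rdiv_lt_0_compat; lra.
Qed.
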